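(* Every bornologous map $f\colon X\to Y$ between coarse spaces functorially induces a map $\mathcal{Q}(f)\colon\mathcal{Q}(X)\to\mathcal{Q}(Y)$ by $\mathcal{Q}(f)(\mathcal{Q}_X(x)):=\mathcal{Q}_Y(f(x))$ for $x\in X$. That is, $\mathcal{Q}(f)$ is well defined, $\mathcal{Q}(\mathrm{id}_X)=\mathrm{id}_{\mathcal{Q}(X)}$ for every coarse space $X$, and $\mathcal{Q}(g\circ f)=\mathcal{Q}(g)\circ\mathcal{Q}(f)$ for all bornologous maps $f\colon X\to Y$ and $g\colon Y\to Z$ between coarse spaces.
   Context: For binary relations $E,F\subseteq X\times X$: $E\circ F=\{(x,y) : (x,z)\in E \text{ and } (z,y)\in F \text{ for some } z\in X\}$, $E^{-1}=\{(y,x):(x,y)\in E\}$, $\Delta_X=\{(x,x):x\in X\}$. For a map $f\colon X\to Y$, $(f\times f)(E)=\{(f(x),f(y)):(x,y)\in E\}$. A coarse structure on a set $X$ is a family $\mathcal{C}_X$ of binary relations on $X$ such that $\Delta_X\in\mathcal{C}_X$; $E\subseteq F\in\mathcal{C}_X$ implies $E\in\mathcal{C}_X$; and $E,F\in\mathcal{C}_X$ implies $E\cup F, E\circ F, E^{-1}\in\mathcal{C}_X$. A set with a coarse structure is a coarse space. A subset $A\subseteq X$ is bounded if $A\times A\in\mathcal{C}_X$; $\mathcal{B}_X$ is the family of bounded subsets. A map $f\colon X\to Y$ between coarse spaces is bornologous if $(f\times f)(E)\in\mathcal{C}_Y$ for all $E\in\mathcal{C}_X$. For a coarse space $X$ and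 $x\in X$, the coarsely connected component of $X$ containing $x$ is $\mathcal{Q}_X(x)=\bigcup\{B : x\in B\in\mathcal{B}_X\}$, and $\mathcal{Q}(X)=\{\mathcal{Q}_X(x): x\in X\}$. *)

(* Defs.v *)
From HB Require Import structures.
From mathcomp Require Export all_boot.
From mathcomp Require Export mathcomp_extra boolp classical_sets.

Set Implicit Arguments.
Unset Strict Implicit.
Unset Printing Implicit Defensive.

Local Open Scope classical_set_scope.
Local Open Scope relation_scope.

(* [F \; E] is the set of (x, y) with E (x, z) and F (z, y) for some z, that
   is, the relation usually written E o F in coarse geometry. *)
HB.mixin Record isCoarse (X : Type) := {
  controlled : set (set (X * X));
  controlled_diagonal : controlled diagonal;
  controlled_sub : forall E F, E `<=` F -> controlled F -> controlled E;
  controlled_setU : forall E F,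
    controlled E -> controlled F -> controlled (E `|` F);
  controlled_comp : forall E F,
    controlled E -> controlled F -> controlled (F \; E);
  controlled_inv : forall E, controlled E -> controlled E^-1
}.

#[short(type="coarseType")]
HB.structure Definition Coarse := {X of isCoarse X}.

Definition bounded_sets (X : coarseType) : set (set X) :=
  [set B | controlled (B `*` B)].
Arguments bounded_sets X : clear implicits.

HB.mixin Record isBornologous (X Y : coarseType) (f : X -> Y) := {
  bornologous : forall E : set (X * X),
    controlled E -> controlled [set (f p.1, f p.2) | p in E]
}.

HB.structure Definition Bornologous (X Y : coarseType) :=
  {f of isBornologous X Y f}.

Notation "{ 'bornologous' X -> Y }" := (Bornologous.type X Y)
  (at level 0, X at level 98, Y at level 99,
   format "{ 'bornologous'  X  ->  Y }") : type_scope.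

Section BornologousCategory.
Variables X Y Z : coarseType.

Lemma bornologous_id (E : set (X * X)) :
  controlled E -> controlled [set (idfun p.1, idfun p.2) | p in E].
Proof. by apply: controlled_sub => _ [[x y] Exy <-]. Qed.

HB.instance Definition _ := isBornologous.Build X X idfun bornologous_id.

Lemma bornologous_comp (f : {bornologous X -> Y}) (g : {bornologous Y -> Z})
    (E : set (X * X)) :
  controlled E -> controlled [set ((g \o f) p.1, (g \o f) p.2) | p in E].
Proof.
move=> /(@bornologous _ _ f)/(@bornologous _ _ g).
by rewrite image_comp.
Qed.

HB.instance Definition _ (f : {bornologous X -> Y})
    (g : {bornologous Y -> Z}) :=
  isBornologous.Build X Z (g \o f) (bornologous_comp f g).

End BornologousCategory.

Definition component (X : coarseType) (x : X) : set X :=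
  \bigcup_(B in [set B | bounded_sets X B /\ B x]) B.

Definition components (X : coarseType) : set (set X) := range (@component X).
Arguments components X : clear implicits.

Lemma component_in (X : coarseType) (x : X) : component x \in components X.
Proof. by apply: mem_set; exists x. Qed.

Definition to_component (X : coarseType) (x : X) : components X :=
  SigSub (component_in x).

(* Main.v *)
Require Import Defs.

Set Implicit Arguments.
Unset Strict Implicit.
Unset Printing Implicit Defensive.

Local Open Scope classical_set_scope.
Local Open Scope relation_scope.

(** Lying in the same component is a property of a single pair: [y] lies in
    the component of [x] exactly when the one-point relation [(x, y)] is
    controlled ([componentP]).  The axioms of a coarse structure say that this
    is an equivalence relation, whose classes are the components, so two
    components coincide as soon as one contains the centre of the other
    ([eq_componentP]).  A bornologous map sends a controlled one-point relation
    to a controlled one-point relation, so it respects this equivalence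
    ([bornologous_component]) and descends to the classes.  Since every
    component is the component of some point, the descended map is determined
    by its values on the components of points ([eq_components_map]).
    Functoriality follows from this uniqueness: the identity and the composite
    take the required values. *)

Section Components.
Variable X : coarseType.
Implicit Types x y z : X.

(** A controlled pair [(x, y)] yields the bounded set [{x, y}], whose square
    consists of diagonal pairs, the pair itself and its inverse; conversely a
    bounded set containing both points has [(x, y)] in its square. *)
Lemma componentP x y : component x y <-> controlled [set (x, y)].
Proof.
split=> [[B [bB Bx] By]|cxy].
  by apply: controlled_sub bB => _ ->.
exists [set x; y]; last by right.
split; last by left.
rewrite /bounded_sets /=.
apply: controlled_sub (controlled_setU _ _ controlled_diagonal
  (controlled_setU _ _ cxy (controlled_inv _ cxy))).
move=> [a b] [] /= [->|->] [->|->].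
- by left.
- by right; left.
- by right; right.
- by left.
Qed.

Lemma component_refl x : component x x.
Proof.
by apply/componentP; apply: controlled_sub controlled_diagonal => _ ->.
Qed.

Lemma component_sym x y : component x y -> component y x.
Proof.
move=> /componentP /controlled_inv cyx; apply/componentP.
by apply: controlled_sub cyx => _ ->.
Qed.

Lemma component_trans y x z : component x y -> component y z -> component x z.
Proof.
move=> /componentP cxy /componentP cyz; apply/componentP.
by apply: controlled_sub (controlled_comp _ _ cxy cyz) => _ ->; exists y.
Qed.

Lemma eq_componentP x y : component x = component y <-> component x y.
Proof.
split=> [->|xy]; first exact: component_refl.
apply/seteqP; split=> z; last exact: component_trans.
exact/component_trans/component_sym.
Qed.

Lemma to_component_surj (c : components X) : exists x, c = to_component x.
Proof.
have [x _ xc] := set_mem (valP c).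
by exists x; apply: val_inj; rewrite /= xc.
Qed.

Lemma eq_components_map (T : Type) (F G : components X -> T) :
  (forall x, F (to_component x) = G (to_component x)) -> F = G.
Proof. by move=> FG; apply/funext => c; have [x ->] := to_component_surj c. Qed.

End Components.

Lemma bornologous_component (X Y : coarseType) (f : {bornologous X -> Y})
    (x y : X) :
  component x y -> component (f x) (f y).
Proof.
move=> /componentP /(@bornologous _ _ f) cfxy; apply/componentP.
by apply: controlled_sub cfxy => _ ->; exists (x, y).
Qed.

Section ComponentsMap.
Variables (X Y : coarseType) (f : {bornologous X -> Y}).

Definition components_map (c : components X) : components Y :=
  to_component (f (sval (cid (to_component_surj c)))).

(** The centre chosen for the component of [x] need not be [x], but it lies in
    that component, so [f] sends it to the component of [f x]. *)
Lemma components_mapE (x : X) :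
  components_map (to_component x) = to_component (f x).
Proof.
rewrite /components_map; case: cid => z /= /(congr1 val) /= xz.
by apply: val_inj; apply/eq_componentP/bornologous_component/eq_componentP.
Qed.

End ComponentsMap.

Theorem theorem2p2 :
  exists Q : forall X Y : coarseType,
      {bornologous X -> Y} -> (components X -> components Y),
    [/\ (* Q(f) is well defined by Q(f)(Q_X(x)) = Q_Y(f(x)): such a map
           exists and is unique *)
        (forall (X Y : coarseType) (f : {bornologous X -> Y}),
           (forall x : X, Q X Y f (to_component x) = to_component (f x)) /\
           (forall F : components X -> components Y,
              (forall x : X, F (to_component x) = to_component (f x)) ->
              F = Q X Y f)),
        (forall X : coarseType, Q X X idfun = idfun)
      & (forall (X Y Z : coarseType)
           (f : {bornologous X -> Y}) (g : {bornologous Y -> Z}),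
           Q X Z (g \o f) = Q Y Z g \o Q X Y f)].
Proof.
exists components_map; split=> [X Y f|X|X Y Z f g].
- split=> [|F FE]; first exact: components_mapE.
  by apply: eq_components_map => x; rewrite FE components_mapE.
- by apply: eq_components_map => x; rewrite components_mapE.
- by apply: eq_components_map => x /=; rewrite !components_mapE.
Qed.
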